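(* The equation $k^2 = 4t^4 - 5t^2s^2 + s^4$ has only trivial solutions in integers. That is, if $t, s, k$ are integers satisfying $k^2 = 4t^4 - 5t^2s^2 + s^4$, then $tsk = 0$.
   Context: A solution $(t_0, s_0, k_0)$ of the equation $k^2 = 4t^4 - 5t^2s^2 + s^4$ is called non-trivial if $t_0 s_0 k_0 \neq 0$, and trivial otherwise. *)

(* Defs.v *)
From mathcomp Require Import all_boot all_order all_algebra.

Set Implicit Arguments.
Unset Strict Implicit.
Unset Printing Implicit Defensive.

Import GRing.Theory Num.Theory.
Local Open Scope ring_scope.

Definition is_solution (t s k : int) : Prop :=
  k ^+ 2 = 4 * t ^+ 4 - 5 * t ^+ 2 * s ^+ 2 + s ^+ 4.

Definition trivial_solution (t s k : int) : Prop := t * s * k = 0.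

(* Main.v *)
(**
  Write the equation as [(s^2 - t^2) (s^2 - 4 t^2) = k^2].  It yields a positive
  solution of the homogeneous equation
    [x^2 (y^2 - z^2) = w^2 (y^2 - 4 z^2)]
  (take [x = k], [w = |s^2 - t^2|], [y = s], [z = t]), where one may assume [x, w]
  coprime and [y, z] coprime.  Then [y^2 - z^2 = e w^2] and
  [y^2 - 4 z^2 = e x^2] with [e] dividing 3, and each of the four values of [e]
  produces coprime [S, T] with [S^2 - T^2] and [S^2 - 4 T^2] both squares and [T]
  dividing one of [x, y, z, w].  Parametrizing the Pythagorean triples with
  hypotenuse [S] and legs [T] and [2 T] gives a new positive coprime solution with
  [2 x y z w = T], and infinite descent on [x y z w] concludes.
*)
Require Import Defs.
From mathcomp Require Import all_boot all_order all_algebra.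
From mathcomp Require Import zify ring.

Local Open Scope nat_scope.

(** The root is [gcdn m k]: its square is the gcd of [m * m], [m * k] and [k * k = m * n], that is,
    [m] times the gcd of [m], [k] and [n], which is 1. *)
Lemma coprime_mul_sqr (m n k : nat) :
  coprime m n -> m * n = k ^ 2 -> exists a, m = a ^ 2.
Proof.
move=> /eqP co_mn mn; exists (gcdn m k).
rewrite -mulnn muln_gcdl !muln_gcdr [k * k]mulnn -mn (mulnC k m).
rewrite -!muln_gcdr -gcdnA (gcdnC k) (gcdnC k) -gcdnA gcdnn gcdnA co_mn.
by rewrite gcd1n muln1.
Qed.

Lemma gcdn_split (m n : nat) : 0 < m ->
  exists d u v, [/\ 0 < d, m = d * u, n = d * v & coprime u v].
Proof.
move=> m_gt0; have d_gt0 : 0 < gcdn m n by rewrite gcdn_gt0 m_gt0.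
have [/dvdnP[u mE] /dvdnP[v nE]] := (dvdn_gcdl m n, dvdn_gcdr m n).
exists (gcdn m n), u, v; split; rewrite // 1?mulnC //.
by rewrite /coprime -(eqn_pmul2l d_gt0) muln_gcdr !(mulnC (gcdn _ _)) -mE -nE mul1n.
Qed.

(** Take [x] to be the gcd of [p] and [m]. Cancelling it leaves [y * q = z * n], so [y], coprime to
    [z], divides [n]. *)
Lemma mul_eq_mul_split (p q m n : nat) : 0 < p -> p * q = m * n ->
  exists x y z w, [/\ p = x * y, q = z * w, m = x * z, n = y * w & coprime y z].
Proof.
move=> p_gt0 pq; have [x [y [z [x_gt0 pE mE co_yz]]]] := gcdn_split _ m p_gt0.
have yq : y * q = z * n.
  by apply/eqP; rewrite -(eqn_pmul2l x_gt0) !mulnA -pE -mE pq.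
have /dvdnP[w nE] : y %| n by rewrite -(Gauss_dvdr n co_yz) -yq dvdn_mulr.
exists x, y, z, w; split; rewrite // 1?[y * w]mulnC //.
have y_gt0 : 0 < y by move: p_gt0; rewrite pE muln_gt0 => /andP[].
by apply/eqP; rewrite -(eqn_pmul2l y_gt0) yq nE; apply/eqP; ring.
Qed.

(** The halves of [s + a] and [s - a] have product [r ^ 2]; they are coprime because their sum [s]
    is coprime to [r], so each is a square. *)
Lemma pythagorean_param (a r s : nat) :
  odd s -> coprime s r -> s ^ 2 = (2 * r) ^ 2 + a ^ 2 ->
  exists m n, [/\ s = m ^ 2 + n ^ 2, r = m * n & coprime m n].
Proof.
move=> odd_s co_sr sE.
have odd_a : odd a.
  have := congr1 odd sE; rewrite oddD !oddX oddM odd_s /=; by case: (odd a).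
have le_as : a <= s by rewrite -leq_sqr sE leq_addl.
pose u := (s + a)./2; pose v := (s - a)./2.
have uE : 2 * u = s + a by rewrite /u; lia.
have vE : 2 * v = s - a by rewrite /v; lia.
have suv : s = u + v by lia.
have uva : u = v + a by lia.
have uv : u * v = r ^ 2 by move: sE; rewrite suv uva; lia.
have co_uv : coprime u v.
  have : coprime s (u * v) by rewrite uv coprimeXr.
  rewrite coprimeMr suv => /andP[+ _].
  by rewrite /coprime gcdnC gcdnDl.
have [m mE] := coprime_mul_sqr _ _ _ co_uv uv.
have [n nE] : exists n, v = n ^ 2.
  by apply: (coprime_mul_sqr v u r); rewrite 1?coprime_sym 1?mulnC.
exists m, n; split; first by rewrite suv mE nE.
  by apply/eqP; rewrite -(eqn_exp2r _ _ (isT : 0 < 2)) -uv mE nE expnMn.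
by move: co_uv; rewrite mE nE coprime_pexpl // coprime_pexpr.
Qed.

(* [x^2 (y^2 - z^2) = w^2 (y^2 - 4 z^2)], free of truncated subtraction. *)
Definition descent_eq (x y z w : nat) : Prop :=
  x ^ 2 * y ^ 2 + 4 * z ^ 2 * w ^ 2 = x ^ 2 * z ^ 2 + y ^ 2 * w ^ 2.

(** Odd squares are 1 modulo 8 and even ones 0 modulo 4. The second equation excludes [s] and [t]
    both odd, the first excludes [s] even with [t] odd. *)
Lemma concordant_parity (s t a b : nat) :
  coprime s t -> s ^ 2 = t ^ 2 + a ^ 2 -> s ^ 2 = 4 * t ^ 2 + b ^ 2 ->
  odd s /\ ~~ odd t.
Proof.
have sq8 n : exists c, n ^ 2 = if odd n then 8 * c + 1 else 4 * c.
  case: (boolP (odd n)) => odd_n; last first.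
    have nE : n = 2 * n./2 by lia.
    by exists (n./2 ^ 2); rewrite {1}nE expnMn.
  have /dvdnP[c cE] : 2 %| n./2 * (n./2).+1.
    by rewrite dvdn2 oddM /=; case: (odd _).
  have nE : n = 2 * n./2 + 1 by lia.
  by exists c; rewrite {1}nE; nia.
move=> co_st; have {co_st} : odd s || odd t.
  apply: contraT; rewrite negb_or -!dvdn2 => /andP[s2 t2].
  by have := dvdn_gcd 2 s t; rewrite s2 t2 (eqP co_st).
have [[cs ->] [ct ->]] := (sq8 s, sq8 t).
have [[ca ->] [cb ->]] := (sq8 a, sq8 b).
case: (odd s) (odd t) (odd a) (odd b) => [] [] [] [] //= _; lia.
Qed.

(** The two triples give [s = m ^ 2 + n ^ 2 = p ^ 2 + 4 * q ^ 2] with [p * q = m * n]. Splitting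
    these products into four common factors turns the equality of the two sums into [descent_eq]. *)
Lemma concordant_descent (s t a b : nat) :
  0 < t -> coprime s t -> s ^ 2 = t ^ 2 + a ^ 2 -> s ^ 2 = 4 * t ^ 2 + b ^ 2 ->
  exists x y z w, [/\ descent_eq x y z w, coprime x w, coprime y z &
    2 * (x * y * z * w) = t].
Proof.
move=> t_gt0 co_st sa sb.
have [odd_s even_t] := concordant_parity _ _ _ _ co_st sa sb.
have tE : t = 2 * t./2 by lia.
have co_sr : coprime s t./2 by move: co_st; rewrite {1}tE coprimeMr => /andP[].
have [||m [n [s_mn r_mn co_mn]]] := pythagorean_param a t./2 s odd_s.
- done.
- by rewrite -tE.
have [p [q [s_pq t_pq co_pq]]] : exists p q,
    [/\ s = p ^ 2 + (2 * q) ^ 2, t = p * (2 * q) & coprime p (2 * q)].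
  have [||p [q [s_pq t_pq co_pq]]] := pythagorean_param b t s odd_s.
  - done.
  - by rewrite sb expnMn.
  (* Since [t] is even, so is one parameter; it is halved and placed second. *)
  have : ~~ odd p || ~~ odd q by rewrite -negb_and -oddM -t_pq.
  case/orP => even_pq.
    exists q, p./2; have <- : p = 2 * p./2 by lia.
    by split; rewrite 1?addnC 1?mulnC 1?coprime_sym.
  by exists p, q./2; have <- : q = 2 * q./2 by lia.
have p_gt0 : 0 < p by move: t_gt0; rewrite t_pq muln_gt0 => /andP[].
have pq_mn : p * q = m * n by lia.
have [x [y [z [w [pE qE mE nE co_yz]]]]] := mul_eq_mul_split _ _ _ _ p_gt0 pq_mn.
exists x, y, z, w; split => //.
- by rewrite /descent_eq -!expnMn -mE -nE -pE -s_mn s_pq qE !expnMn mulnA.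
- by move: co_mn; rewrite mE nE coprimeMl !coprimeMr => /andP[/andP[]].
- by rewrite t_pq pE qE; ring.
Qed.

(** As [w ^ 2] is coprime to [x ^ 2], it divides the difference of [y ^ 2] and [z ^ 2]; [e] is the
    quotient. Eliminating [z] or [y] shows that [e] divides [3 * y ^ 2] and [3 * z ^ 2], hence 3. *)
Lemma descent_square_factor (x y z w : nat) :
  0 < x -> 0 < z -> 0 < w -> coprime x w -> coprime y z -> descent_eq x y z w ->
  exists2 e, e = 1 \/ e = 3 &
    y ^ 2 = z ^ 2 + e * w ^ 2 /\ y ^ 2 = 4 * z ^ 2 + e * x ^ 2
    \/ z ^ 2 = y ^ 2 + e * w ^ 2 /\ 4 * z ^ 2 = y ^ 2 + e * x ^ 2.
Proof.
move=> x_gt0 z_gt0 w_gt0 co_xw co_yz eq_xyzw.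
have co_wx2 : coprime (w ^ 2) (x ^ 2).
  by rewrite coprime_pexpl // coprime_pexpr // coprime_sym.
have w2_gt0 : 0 < w ^ 2 by rewrite expn_gt0 w_gt0.
have dvd3 e : (e %| 3 * y ^ 2) -> (e %| 3 * z ^ 2) -> e = 1 \/ e = 3.
  move=> ey ez; have : e %| gcdn (3 * y ^ 2) (3 * z ^ 2) by rewrite dvdn_gcd ey.
  have /eqP co2 : coprime (y ^ 2) (z ^ 2) by rewrite coprime_pexpl // coprime_pexpr.
  rewrite -muln_gcdr co2 muln1 => e3.
  by have /primeP[_ /(_ _ e3)/orP[]/eqP] := isT : prime 3; [left | right].
have [lt_yz | lt_zy | eq_yz] := ltngtP y z.
- have le2 : y ^ 2 <= z ^ 2 by rewrite leq_sqr ltnW.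
  have /dvdnP[e eE] : w ^ 2 %| z ^ 2 - y ^ 2.
    rewrite -(Gauss_dvdr _ co_wx2); apply/dvdnP; exists (4 * z ^ 2 - y ^ 2).
    by move: eq_xyzw; rewrite /descent_eq; nia.
  have zE : z ^ 2 = y ^ 2 + e * w ^ 2 by lia.
  have xE : 4 * z ^ 2 = y ^ 2 + e * x ^ 2.
    apply/eqP; rewrite -(eqn_pmul2r w2_gt0); apply/eqP.
    by move: eq_xyzw; rewrite /descent_eq; nia.
  exists e; last by right.
  apply: dvd3; apply/dvdnP.
    by exists (x ^ 2 - 4 * w ^ 2); nia.
  by exists (x ^ 2 - w ^ 2); nia.
- have le2 : z ^ 2 <= y ^ 2 by rewrite leq_sqr ltnW.
  (* The left side [x ^ 2 * (y ^ 2 - z ^ 2)] is positive, hence so is the right one. *)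
  have le4 : 4 * z ^ 2 <= y ^ 2.
    by move: eq_xyzw; rewrite /descent_eq; nia.
  have /dvdnP[e eE] : w ^ 2 %| y ^ 2 - z ^ 2.
    rewrite -(Gauss_dvdr _ co_wx2); apply/dvdnP; exists (y ^ 2 - 4 * z ^ 2).
    by move: eq_xyzw; rewrite /descent_eq; nia.
  have yE : y ^ 2 = z ^ 2 + e * w ^ 2 by lia.
  have xE : y ^ 2 = 4 * z ^ 2 + e * x ^ 2.
    apply/eqP; rewrite -(eqn_pmul2r w2_gt0); apply/eqP.
    by move: eq_xyzw; rewrite /descent_eq; nia.
  exists e; last by left.
  apply: dvd3; apply/dvdnP.
    by exists (4 * w ^ 2 - x ^ 2); nia.
  by exists (w ^ 2 - x ^ 2); nia.
- by move: eq_xyzw; rewrite /descent_eq eq_yz; nia.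
Qed.

Lemma descent_eq_concordant (x y z w : nat) :
  0 < x -> 0 < y -> 0 < z -> 0 < w -> coprime x w -> coprime y z ->
  descent_eq x y z w ->
  exists s t a b, [/\ 0 < t, coprime s t, s ^ 2 = t ^ 2 + a ^ 2,
    s ^ 2 = 4 * t ^ 2 + b ^ 2 & t <= x * y * z * w].
Proof.
move=> x_gt0 y_gt0 z_gt0 w_gt0 co_xw co_yz eq_xyzw.
(* The equation [4 s^2 = c^2 + d^2] forces [c] and [d] to be even. *)
have halve s c a d : 0 < c -> coprime s c ->
    s ^ 2 = c ^ 2 + a ^ 2 -> 4 * s ^ 2 = c ^ 2 + d ^ 2 ->
    exists t b, [/\ 0 < t, coprime s t, s ^ 2 = t ^ 2 + b ^ 2,
      s ^ 2 = 4 * t ^ 2 + a ^ 2 & t <= c].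
  move=> c_gt0 co_sc sa sd.
  have [even_c even_d] : ~~ odd c /\ ~~ odd d.
    have cdE : (c ^ 2 + d ^ 2) %% 4 = 0 by rewrite -sd modnMr.
    have sq4 n : exists k, n ^ 2 = 4 * k + odd n.
      exists (n./2 ^ 2 + odd n * n./2); rewrite -{1}(odd_double_half n).
      by case: (odd n); lia.
    move: cdE; have [[kc ->] [kd ->]] := (sq4 c, sq4 d).
    by case: (odd c) (odd d) => [] [] //=; lia.
  have [cE dE] : c = 2 * c./2 /\ d = 2 * d./2 by lia.
  exists c./2, d./2; split.
  - by lia.
  - by move: co_sc; rewrite {1}cE coprimeMr => /andP[].
  - move: sd; rewrite {1}cE {1}dE !expnMn -mulnDr.
    by move/eqP; rewrite eqn_pmul2l // => /eqP.
  - by move: sa; rewrite {1}cE expnMn.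
  - by lia.
have P_gt0 : 0 < x * y * z * w by rewrite !muln_gt0 x_gt0 y_gt0 z_gt0.
have le_x : x <= x * y * z * w.
  by apply: dvdn_leq => //; rewrite -!mulnA dvdn_mulr.
have le_y : y <= x * y * z * w.
  by apply: dvdn_leq => //; rewrite -!mulnA dvdn_mull ?dvdn_mulr.
have le_z : z <= x * y * z * w.
  by apply: dvdn_leq => //; rewrite dvdn_mulr ?dvdn_mull.
have le_w : w <= x * y * z * w by apply: dvdn_leq => //; rewrite dvdn_mull.
have [e [] -> []] := descent_square_factor
  _ _ _ _ x_gt0 z_gt0 w_gt0 co_xw co_yz eq_xyzw.
- by rewrite !mul1n => -[yw yx]; exists y, z, w, x.
- rewrite !mul1n => -[zw zx].
  have [|t [b [? ? ? ? le_t]]] := halve z y w x y_gt0 _ zw zx.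
    by rewrite coprime_sym.
  by exists z, t, b, w; split; rewrite ?(leq_trans le_t).
(* Eliminating gives [w ^ 2 = x ^ 2 + z ^ 2] and [4 * w ^ 2 = x ^ 2 + y ^ 2]. *)
- move=> [yw yx].
  have [|||t [b [? ? ? ? le_t]]] := halve w x z y x_gt0.
  + by rewrite coprime_sym.
  + by lia.
  + by lia.
  by exists w, t, b, z; split; rewrite ?(leq_trans le_t).
- by move=> [zw zx]; exists x, w, z, y; split => //; lia.
Qed.

Lemma no_coprime_descent (x y z w : nat) :
  0 < x -> 0 < y -> 0 < z -> 0 < w -> coprime x w -> coprime y z ->
  ~ descent_eq x y z w.
Proof.
have [n] := ubnP (x * y * z * w); elim: n => // n IHn in x y z w *.
rewrite ltnS => le_n x_gt0 y_gt0 z_gt0 w_gt0 co_xw co_yz eq_xyzw.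
have [s [t [a [b [t_gt0 co_st sa sb le_t]]]]] :=
  descent_eq_concordant _ _ _ _ x_gt0 y_gt0 z_gt0 w_gt0 co_xw co_yz eq_xyzw.
have [x' [y' [z' [w' [eq' co_xw' co_yz' tE]]]]] :=
  concordant_descent _ _ _ _ t_gt0 co_st sa sb.
(* Twice the new product is [t], which is positive and at most the old product, so the descent is
   strict. *)
have : 0 < x' * y' * z' * w' by lia.
rewrite !muln_gt0 => /andP[/andP[/andP[? ?] ?] ?].
by apply: (IHn x' y' z' w') => //; lia.
Qed.

(** The equation is homogeneous in [x, w] and, separately, in [y, z], so both gcds can be divided
    out. *)
Lemma no_descent (x y z w : nat) :
  0 < x -> 0 < y -> 0 < z -> 0 < w -> ~ descent_eq x y z w.
Proof.
move=> x_gt0 y_gt0 z_gt0 w_gt0.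
have [d [x' [w' [d_gt0 xE wE co_xw]]]] := gcdn_split x w x_gt0.
have [g [y' [z' [g_gt0 yE zE co_yz]]]] := gcdn_split y z y_gt0.
move: x_gt0 y_gt0 z_gt0 w_gt0; rewrite xE yE zE wE !muln_gt0 d_gt0 g_gt0 /=.
move=> x_gt0 y_gt0 z_gt0 w_gt0 eq_xyzw.
apply: (no_coprime_descent x' y' z' w') => //.
have dg_gt0 : 0 < (d * g) ^ 2 by rewrite expn_gt0 muln_gt0 d_gt0 g_gt0.
apply/eqP; rewrite -(eqn_pmul2l dg_gt0); apply/eqP.
by move: eq_xyzw; rewrite /descent_eq !expnMn; lia.
Qed.

Import GRing.Theory Num.Theory.
Local Open Scope ring_scope.

Theorem theorem1p3 (t s k : int) :
  is_solution t s k -> trivial_solution t s k.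
Proof.
rewrite /is_solution /trivial_solution => kE; apply/eqP; apply: contraT.
rewrite !mulf_eq0 !negb_or => /andP[/andP[t_neq0 s_neq0] k_neq0].
have k2 : k ^+ 2 = (s ^+ 2 - t ^+ 2) * (s ^+ 2 - 4 * t ^+ 2) by rewrite kE; ring.
pose w := s ^+ 2 - t ^+ 2.
have w_neq0 : w != 0.
  by apply: contraNneq k_neq0 => w0; rewrite -sqrf_eq0 k2 -/w w0 mul0r.
(* Multiplying [k2] by [w] gives the descent equation. *)
case: (no_descent `|k| `|s| `|t| `|w|); rewrite ?absz_gt0 //.
have sqE (n : int) : (`|n|%N : int) * `|n|%N = n ^+ 2.
  by rewrite -PoszM mulnn -abszX abszE ger0_norm ?sqr_ge0.
apply/eqP; rewrite /descent_eq -eqz_nat !PoszD !PoszM !sqE k2 /w.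
by apply/eqP; ring.
Qed.
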